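(* Let $n\geqslant1$, let $M\in\{\mathrm{IEnd}(S_n),\mathrm{PEnd}(S_n),\mathrm{PwEnd}(S_n)\}$ and let $\alpha,\beta\in M$. Then $\alpha\,\mathscr{R}\,\beta$ in $M$ if and only if one of the following properties is satisfied: (1) $\mathrm{Ker}(\alpha)=\mathrm{Ker}(\beta)$ and $|\mathrm{Im}(\alpha)|\leqslant1$; (2) $\mathrm{Ker}(\alpha)=\mathrm{Ker}(\beta)$, $|\mathrm{Im}(\alpha)|\geqslant2$, [$0\in\mathrm{Im}(\alpha)$ if and only if $0\in\mathrm{Im}(\beta)$], and, if $0\in\mathrm{Im}(\alpha)$, then either $0\alpha^{-1}=0\beta^{-1}$ or $0\alpha^{-1}$ and $0\beta^{-1}$ are the only kernel classes of $\alpha$.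
   Context: For $n\geqslant1$, the star graph $S_n$ is the simple graph with vertex set $V=\{0,1,\ldots,n-1\}$ and edge set $E=\{\{0,i\}\mid 1\leqslant i\leqslant n-1\}$. $\mathcal{PT}(V)$ is the monoid of all partial transformations of $V$ (including the empty one) under composition; maps are written on the right and composed left to right. For a graph $G=(V,E)$, $\mathrm{PEnd}(G)$ is the monoid of partial endomorphisms: those $\alpha\in\mathcal{PT}(V)$ with $\{u,v\}\in E\Rightarrow\{u\alpha,v\alpha\}\in E$ for all $u,v\in\mathrm{Dom}(\alpha)$. $\mathrm{PwEnd}(G)$ is the monoid of partial weak endomorphisms: those $\alpha\in\mathcal{PT}(V)$ such that $\{u,v\}\in E$ and $u\alpha\neq v\alpha$ imply $\{u\alpha,v\alpha\}\in E$ for all $u,v\in\mathrm{Dom}(\alpha)$. $\mathrm{IEnd}(G)$ is the monoid of injective elements of $\mathrm{PEnd}(G)$. $\mathrm{Ker}(\alpha)=\{(x,y)\in\mathrm{Dom}(\alpha)\times\mathrm{Dom}(\alpha)\mid x\alpha=y\alpha\}$, an equivalence relation on $\mathrm{Dom}(\alpha)$ whose classes are the kernel classes of $\alpha$ (so $\mathrm{Ker}(\alpha)=\mathrm{Ker}(\beta)$ forces $\mathrm{Dom}(\alpha)=\mathrm{Dom}(\beta)$). For $y\in\mathrm{Im}(\alpha)$, $y\alpha^{-1}=\{x\in\mathrm{Dom}(\alpha)\mid x\alpha=y\}$. Green's relation $\mathscr{R}$ on a monoid $M$: $\alpha\,\mathscr{R}\,\beta$ iff $\alpha M=\beta M$.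 *)

(* Defs.v *)
From HB Require Import structures.
From mathcomp Require Import all_boot.

Set Implicit Arguments.
Unset Strict Implicit.
Unset Printing Implicit Defensive.

Local Open Scope group_scope.

Section PartialTransformations.
Variable V : finType.

(* [None] marks the vertices outside the domain. *)
Definition ptrans : Type := {ffun V -> option V}.

HB.instance Definition _ := Finite.copy ptrans {ffun V -> option V}.

Implicit Types a b c : ptrans.

(* Maps act on the right: first [a], then [b]. *)
Definition pt_mul a b : ptrans := [ffun x => obind b (a x)].
Definition pt_one : ptrans := [ffun x => Some x].

Lemma pt_mulA : associative pt_mul.
Proof.
by move=> a b c; apply/ffunP=> x; rewrite !ffunE; case: (a x) => //= y; rewrite ffunE.
Qed.

Lemma pt_mul1 : left_id pt_one pt_mul.
Proof. by move=> a; apply/ffunP=> x; rewrite !ffunE. Qed.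

Lemma pt_mulr1 : right_id pt_one pt_mul.
Proof.
by move=> a; apply/ffunP=> x; rewrite !ffunE; case: (a x) => //= y; rewrite ffunE.
Qed.

HB.instance Definition _ := isMonoid.Build ptrans pt_mulA pt_mul1 pt_mulr1.

Lemma pt_mulE a b x : (a * b) x = obind b (a x).
Proof. by rewrite ffunE. Qed.

Lemma pt_oneE x : (1 : ptrans) x = Some x.
Proof. by rewrite ffunE. Qed.

Definition pt_dom a : {set V} := [set x | a x != None].
Definition pt_im a : {set V} := [set y | [exists x, a x == Some y]].
Definition pt_ker a : {set V * V} :=
  [set p | [&& p.1 \in pt_dom a, p.2 \in pt_dom a & a p.1 == a p.2]].
Definition pt_preim a (y : V) : {set V} := [set x | a x == Some y].
Definition kernel_classes a : {set {set V}} :=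
  equivalence_partition (fun x y => (x, y) \in pt_ker a) (pt_dom a).

Definition greenR (M : {set ptrans}) a b : Prop :=
  [set a * m | m in M] = [set b * m | m in M].

End PartialTransformations.

Section PartialEndomorphisms.
Variables (V : finType) (E : {set {set V}}).

Definition PEnd : {set ptrans V} :=
  [set a : ptrans V | [forall u, forall v, forall u', forall v',
    [&& a u == Some u', a v == Some v' & [set u; v] \in E]
      ==> ([set u'; v'] \in E)]].

Definition PwEnd : {set ptrans V} :=
  [set a : ptrans V | [forall u, forall v, forall u', forall v',
    [&& a u == Some u', a v == Some v', [set u; v] \in E & u' != v']
      ==> ([set u'; v'] \in E)]].

Definition IEnd : {set ptrans V} :=
  [set a in PEnd | dinjectiveb a (pt_dom a)].

Lemma PEndP (a : ptrans V) :
  reflect (forall u v u' v', a u = Some u' -> a v = Some v' ->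
             [set u; v] \in E -> [set u'; v'] \in E)
          (a \in PEnd).
Proof.
rewrite inE; apply: (iffP forallP) => [H u v u' v' Hu Hv Euv | H u].
  have /forallP/(_ v)/forallP/(_ u')/forallP/(_ v')/implyP := H u.
  by apply; rewrite Hu Hv !eqxx.
apply/forallP=> v; apply/forallP=> u'; apply/forallP=> v'.
by apply/implyP=> /and3P[/eqP Hu /eqP Hv]; apply: H.
Qed.

Lemma PwEndP (a : ptrans V) :
  reflect (forall u v u' v', a u = Some u' -> a v = Some v' ->
             [set u; v] \in E -> u' != v' -> [set u'; v'] \in E)
          (a \in PwEnd).
Proof.
rewrite inE; apply: (iffP forallP) => [H u v u' v' Hu Hv Euv Duv | H u].
  have /forallP/(_ v)/forallP/(_ u')/forallP/(_ v')/implyP := H u.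
  by apply; rewrite Hu Hv Duv !eqxx Euv.
apply/forallP=> v; apply/forallP=> u'; apply/forallP=> v'.
by apply/implyP=> /and4P[/eqP Hu /eqP Hv]; apply: H.
Qed.

Lemma IEndP (a : ptrans V) :
  reflect (a \in PEnd /\
           forall x y z, a x = Some z -> a y = Some z -> x = y)
          (a \in IEnd).
Proof.
have -> : (a \in IEnd) = (a \in PEnd) && dinjectiveb a (pt_dom a).
  by rewrite [a \in IEnd]inE.
apply: (iffP andP) => -[aP ainj]; split=> //.
  move=> x y z Hx Hy; move/dinjectiveP: ainj; apply; last by rewrite Hx Hy.
    by rewrite inE Hx.
  by rewrite inE Hy.
apply/dinjectiveP=> x y; rewrite !inE.
by case Hx: (a x) => [z|] // _ _ /esym Hy; apply: ainj Hx Hy.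
Qed.

Lemma PEnd_monoid : monoid_closed PEnd.
Proof.
split=> [|a b /PEndP aP /PEndP bP]; apply/PEndP=> u v u' v'.
  by rewrite !pt_oneE => -[<-] [<-].
rewrite !pt_mulE; case Hu: (a u) => [u1|] //=; case Hv: (a v) => [v1|] //=.
by move=> Hu1 Hv1 Euv; apply: bP Hu1 Hv1 _; apply: aP Hu Hv Euv.
Qed.

Lemma PwEnd_monoid : monoid_closed PwEnd.
Proof.
split=> [|a b /PwEndP aP /PwEndP bP]; apply/PwEndP=> u v u' v'.
  by rewrite !pt_oneE => -[<-] [<-].
rewrite !pt_mulE; case Hu: (a u) => [u1|] //=; case Hv: (a v) => [v1|] //=.
move=> Hu1 Hv1 Euv Duv; apply: (bP _ _ _ _ Hu1 Hv1) => //.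
apply: aP Hu Hv Euv _; apply: contraNneq Duv => D.
by move: Hu1; rewrite D Hv1 => -[->].
Qed.

Lemma IEnd_monoid : monoid_closed IEnd.
Proof.
have [P1 PM] := PEnd_monoid.
split=> [|a b /IEndP[aP ainj] /IEndP[bP binj]]; apply/IEndP; split.
- exact: P1.
- by move=> x y z; rewrite !pt_oneE => -[->] [->].
- exact: PM.
move=> x y z; rewrite !pt_mulE.
case Hx: (a x) => [x1|] //=; case Hy: (a y) => [y1|] //= Hx1 Hy1.
by apply: ainj Hx _; rewrite Hy (binj _ _ _ Hx1 Hy1).
Qed.

End PartialEndomorphisms.

Definition star_center (n : nat) (hn : 0 < n) : 'I_n := Ordinal hn.

Definition star_edges (n : nat) (hn : 0 < n) : {set {set 'I_n}} :=
  [set [set star_center hn; i] | i : 'I_n & 0 < i].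

Lemma card_star_edge (n : nat) (hn : 0 < n) (e : {set 'I_n}) :
  e \in star_edges hn -> #|e| = 2.
Proof.
case/imsetP=> i; rewrite inE => i_gt0 ->; rewrite cards2.
by rewrite -val_eqE /= eq_sym -lt0n i_gt0.
Qed.

(* Main.v *)
(** Since [M] contains [IEnd], the only candidate multiplier carrying [a] to
[b], namely the bijection [x a |-> x b] with domain exactly [Im a], lies in [M]
as soon as it preserves edges.  Hence, for every loopless graph, [a] and [b] are
R-related iff they have the same kernel and [{x a, y a}] is an edge exactly when
[{x b, y b}] is.  In a star, a pair of distinct vertices is an edge iff it
contains the center, which turns this condition into one on the preimages of the
center. *)

Require Import Defs.
From mathcomp Require Import all_boot.

Set Implicit Arguments.
Unset Strict Implicit.
Unset Printing Implicit Defensive.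

(** * Kernels, images and kernel classes of partial maps *)

Section Kernel.
Variable V : finType.
Implicit Types a b : ptrans V.

Lemma in_pt_ker a x y : ((x, y) \in pt_ker a) = (a x != None) && (a x == a y).
Proof.
by rewrite !inE /=; case: (a x) => [u|] //=; case: (a y).
Qed.

Lemma pt_kerP a b :
  pt_ker a = pt_ker b <->
  forall x y, (a x != None) && (a x == a y) = (b x != None) && (b x == b y).
Proof.
split=> [eqK x y|eqK]; first by rewrite -!in_pt_ker eqK.
by apply/setP => -[x y]; rewrite !in_pt_ker.
Qed.

(** The diagonal pairs of a kernel encode the domain. *)
Lemma pt_ker_dom a b x u :
  pt_ker a = pt_ker b -> a x = Some u -> exists u', b x = Some u'.
Proof.
move=> /pt_kerP/(_ x x) + ax; rewrite ax eqxx /= eqxx andbT.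
by case: (b x) => [u'|] // _; exists u'.
Qed.

Lemma pt_ker_eq a b x y u v u' v' : pt_ker a = pt_ker b ->
  a x = Some u -> a y = Some v -> b x = Some u' -> b y = Some v' ->
  (u == v) = (u' == v').
Proof.
by move=> /pt_kerP/(_ x y) + ax ay bx by_; rewrite ax ay bx by_ /=.
Qed.

Lemma pt_imP a y : reflect (exists x, a x = Some y) (y \in pt_im a).
Proof. by rewrite inE; apply: (iffP existsP) => -[x]; exists x; apply/eqP. Qed.

Lemma in_pt_preim a x y : (x \in pt_preim a y) = (a x == Some y).
Proof. by rewrite inE. Qed.

Lemma pt_im_gt1P a :
  reflect (exists x y u v, [/\ a x = Some u, a y = Some v & u != v])
          (1 < #|pt_im a|).
Proof.
apply: (iffP card_gt1P) => [[u [v [/pt_imP[x ax] /pt_imP[y ay] uv]]]|].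
  by exists x, y, u, v.
move=> [x [y [u [v [ax ay uv]]]]]; exists u, v; split=> //.
  by apply/pt_imP; exists x.
by apply/pt_imP; exists y.
Qed.

Lemma pt_im_gt1_ker a b :
  pt_ker a = pt_ker b -> 1 < #|pt_im a| -> 1 < #|pt_im b|.
Proof.
move=> eqK /pt_im_gt1P[x [y [u [v [ax ay uv]]]]].
have [u' bx] := pt_ker_dom eqK ax; have [v' by_] := pt_ker_dom eqK ay.
by apply/pt_im_gt1P; exists x, y, u', v'; rewrite -(pt_ker_eq eqK ax ay bx by_).
Qed.

Lemma kernel_class_preim a x u :
  a x = Some u -> [set y in pt_dom a | (x, y) \in pt_ker a] = pt_preim a u.
Proof.
move=> ax; apply/setP=> y; rewrite inE in_pt_ker ax in_pt_preim inE /=.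
by rewrite [RHS]eq_sym; case: (Some u =P a y) => [<-|]; rewrite ?andbF.
Qed.

Lemma preim_kernel_class a x u :
  a x = Some u -> pt_preim a u \in kernel_classes a.
Proof.
move=> ax; apply/imsetP; exists x; first by rewrite inE ax.
by rewrite (kernel_class_preim ax).
Qed.

Lemma kernel_classesP a B :
  reflect (exists x u, a x = Some u /\ B = pt_preim a u)
          (B \in kernel_classes a).
Proof.
apply: (iffP imsetP) => [[x]|[x [u [ax ->]]]].
  rewrite inE; case ax: (a x) => [u|] // _ ->.
  by exists x, u; rewrite (kernel_class_preim ax).
by exists x; rewrite ?inE ?ax // (kernel_class_preim ax).
Qed.

(** Both sides are the class of [x] under the common kernel. *)
Lemma preim_ker a b x u u' : pt_ker a = pt_ker b ->
  a x = Some u -> b x = Some u' -> pt_preim a u = pt_preim b u'.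
Proof.
move=> eqK ax bx.
apply/setP=> y; rewrite !in_pt_preim -ax -bx.
by move/pt_kerP/(_ x y): eqK; rewrite ax bx /= !(eq_sym (Some _)).
Qed.

End Kernel.

(** * The canonical multiplier *)

Section Transport.
Variable V : finType.
Implicit Types a b : ptrans V.

(** [pick] chooses some preimage under [a]; points outside the image of [a] get [None], so
    injectivity and edges need checking only on that image. *)
Definition transport a b : ptrans V :=
  [ffun y => obind b [pick x | a x == Some y]].

(** Equal kernels make [b] constant on each fibre of [a], so the preimage chosen by [pick] does not
    matter. *)
Lemma transportE a b x u :
  pt_ker a = pt_ker b -> a x = Some u -> transport a b u = b x.
Proof.
move=> eqK ax; rewrite ffunE; case: pickP => [x' /eqP ax'|/(_ x)]; last first.
  by rewrite ax eqxx.
by have /pt_kerP/(_ x' x) := eqK; rewrite ax ax' eqxx => /esym/andP[_ /eqP].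
Qed.

Lemma transport_dom a b u u' :
  transport a b u = Some u' -> exists2 x, a x = Some u & b x = Some u'.
Proof. by rewrite ffunE; case: pickP => [x /eqP ax bx|//]; exists x. Qed.

Lemma mul_transport a b : pt_ker a = pt_ker b -> (a * transport a b)%g = b.
Proof.
move=> eqK; apply/ffunP=> x; rewrite pt_mulE; case ax: (a x) => [u|] /=.
  exact: transportE eqK ax.
have /pt_kerP/(_ x x) := eqK; rewrite ax !eqxx andbT.
by case: (b x).
Qed.

End Transport.

(** * Green's relation R over a loopless graph *)

Section GreenR.
Variables (V : finType) (E : {set {set V}}) (M : {set ptrans V}).
Hypothesis loopless : forall x, [set x; x] \notin E.
Hypothesis M_closed : monoid_closed M.
Hypothesis sub_IEnd_M : IEnd E \subset M.
Hypothesis sub_M_PwEnd : M \subset PwEnd E.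
Implicit Types a b : ptrans V.

Definition edge_sub a b : Prop := forall x y u v u' v',
  a x = Some u -> a y = Some v -> b x = Some u' -> b y = Some v' ->
  [set u; v] \in E -> [set u'; v'] \in E.

(** The identity puts each map into its own right ideal, and closure under products turns
    divisibility into inclusion of ideals. *)
Lemma greenRP a b :
  greenR M a b <->
  (exists2 m, m \in M & b = (a * m)%g) /\ (exists2 m, m \in M & a = (b * m)%g).
Proof.
have [M1 MM] := M_closed.
have memI (c : ptrans V) : c \in [set (c * m)%g | m in M].
  by apply/imsetP; exists 1%g; rewrite ?mulg1.
have sub (c d : ptrans V) : (exists2 m, m \in M & d = (c * m)%g) ->
    [set (d * m)%g | m in M] \subset [set (c * m)%g | m in M].
  case=> m Mm ->; apply/subsetP => _ /imsetP[m' Mm' ->].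
  by apply/imsetP; exists (m * m')%g; rewrite ?mulgA //; apply: MM.
split=> [eqR|[ab ba]]; last by apply/eqP; rewrite eqEsubset !sub.
by split; apply/imsetP; [rewrite -/(greenR M a b) eqR | rewrite -eqR]; apply: memI.
Qed.

(** Right multiplication can only shrink the domain and merge kernel classes; multiplying there and
    back therefore does neither. *)
Lemma mul_pt_ker a b m m' :
  b = (a * m)%g -> a = (b * m')%g -> pt_ker a = pt_ker b.
Proof.
have sub (c d k : ptrans V) : d = (c * k)%g -> forall x y,
    c x == c y -> d x == d y.
  by move=> -> x y /eqP cxy; rewrite !pt_mulE cxy.
have dom (c d k : ptrans V) x : d = (c * k)%g -> d x != None -> c x != None.
  by move=> ->; rewrite pt_mulE; case: (c x).
move=> ab ba; apply/pt_kerP => x y.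
by apply/andP/andP => -[dx xy]; split;
   [exact: dom ba dx | exact: sub ab _ _ xy
   |exact: dom ab dx | exact: sub ba _ _ xy].
Qed.

(** A weak endomorphism may collapse an edge, but not here: the ends are distinct as there are no
    loops, and equal kernels keep their images distinct. *)
Lemma mul_edge_sub a b m : m \in M -> pt_ker a = pt_ker b ->
  b = (a * m)%g -> edge_sub a b.
Proof.
move=> /(subsetP sub_M_PwEnd)/PwEndP mP eqK def_b x y u v u' v' ax ay bx by_ uvE.
have mu : m u = Some u' by move: bx; rewrite def_b pt_mulE ax.
have mv : m v = Some v' by move: by_; rewrite def_b pt_mulE ay.
apply: (mP _ _ _ _ mu mv uvE); rewrite -(pt_ker_eq eqK ax ay bx by_).
by apply: contraTneq uvE => ->; apply: loopless.
Qed.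

(** Equal kernels give injectivity, and [edge_sub] gives preservation of edges. *)
Lemma transport_IEnd a b :
  pt_ker a = pt_ker b -> edge_sub a b -> transport a b \in IEnd E.
Proof.
move=> eqK sub; apply/IEndP; split.
  apply/PEndP => u v u' v' /transport_dom[x ax bx] /transport_dom[y ay by_].
  exact: sub ax ay bx by_.
move=> u v w /transport_dom[x ax bx] /transport_dom[y ay by_].
by apply/eqP; rewrite (pt_ker_eq eqK ax ay bx by_).
Qed.

Lemma greenR_edgeP a b :
  greenR M a b <-> [/\ pt_ker a = pt_ker b, edge_sub a b & edge_sub b a].
Proof.
apply: (iff_trans (greenRP a b)); split=> [[[m Mm ab] [m' Mm' ba]]|[eqK sab sba]].
  have eqK := mul_pt_ker ab ba.
  by split=> //; [apply: mul_edge_sub Mm _ ab | apply: mul_edge_sub Mm' _ ba].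
by split; [exists (transport a b) | exists (transport b a)];
   rewrite ?mul_transport ?(subsetP sub_IEnd_M) ?transport_IEnd.
Qed.

End GreenR.

Lemma IEnd_sub_PEnd (V : finType) (E : {set {set V}}) : IEnd E \subset PEnd E.
Proof. by apply/subsetP => a /IEndP[]. Qed.

Lemma PEnd_sub_PwEnd (V : finType) (E : {set {set V}}) : PEnd E \subset PwEnd E.
Proof.
apply/subsetP => a /PEndP aP; apply/PwEndP => u v u' v' au av uvE _.
exact: aP au av uvE.
Qed.

(** * The edge condition in a star *)

Section Star.
Variables (n : nat) (hn : 0 < n).
Local Notation z := (star_center hn).
Local Notation E := (star_edges hn).
Implicit Types a b : ptrans 'I_n.

Lemma star_loopless (x : 'I_n) : [set x; x] \notin E.
Proof.
by apply/negP => /card_star_edge; rewrite cards2 eqxx.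
Qed.

Lemma star_edgeE (u v : 'I_n) :
  ([set u; v] \in E) = (u != v) && ((u == z) || (v == z)).
Proof.
have gt0 (i : 'I_n) : (0 < i) = (i != z) by rewrite -val_eqE lt0n.
apply/idP/andP => [uvE|[uv]].
  have uv : u != v by apply: contraTneq uvE => ->; apply: star_loopless.
  (* The center lies in the edge, so testing the equality of sets at [z] suffices. *)
  split=> //; case/imsetP: uvE => i _ /setP/(_ z).
  by rewrite !inE eqxx /= ![z == _]eq_sym.
case/orP=> /eqP eqz; apply/imsetP; [exists v | exists u].
- by rewrite inE gt0 -eqz eq_sym.
- by rewrite eqz.
- by rewrite inE gt0 -eqz.
- by rewrite eqz setUC.
Qed.

(** Edges inside the image of [a] join [z] to another point. If [b] moves the fibre of [a] over [z]
    off the center, the other end of each such edge must land on the center. *)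
Lemma star_edge_subP a b : pt_ker a = pt_ker b ->
  edge_sub E a b <->
  forall x y u' v, a x = Some z -> b x = Some u' -> u' != z ->
    a y = Some v -> v != z -> b y = Some z.
Proof.
move=> eqK; split=> [sub x y u' v ax bx u'z ay vz|sub].
  have [v' by_] := pt_ker_dom eqK ay; rewrite by_.
  have := sub _ _ _ _ _ _ ax ay bx by_.
  by rewrite !star_edgeE eqxx eq_sym vz (negbTE u'z) /= => /(_ isT)/andP[_ /eqP->].
(* The case where the first end is the center; the other case follows by symmetry. *)
have half x y v u' v' : a x = Some z -> a y = Some v -> v != z ->
    b x = Some u' -> b y = Some v' -> (u' == z) || (v' == z).
  move=> ax ay vz bx by_; have [//|u'z] := eqVneq u' z.
  by move: (sub _ _ _ _ ax bx u'z ay vz); rewrite by_ => -[->]; apply/eqP.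
move=> x y u v u' v' ax ay bx by_; rewrite !star_edgeE -(pt_ker_eq eqK ax ay bx by_).
case/andP=> uv; rewrite uv /= => /orP[] /eqP eqz; subst.
  by apply: (half x y v); rewrite // eq_sym.
by rewrite orbC; apply: (half y x u).
Qed.

(** A second image point gives some [y] sent off the center by [a]; if [b] moves the central fibre
    of [a] away, it sends [y] to the center. *)
Lemma star_center_im a b : pt_ker a = pt_ker b -> edge_sub E a b ->
  1 < #|pt_im a| -> z \in pt_im a -> z \in pt_im b.
Proof.
move=> eqK /(star_edge_subP eqK) sub /card_gt1P[u [v [ua va uv]]] /pt_imP[x ax].
have [y [w [ay wz]]] : exists y w, a y = Some w /\ w != z.
  have [uz|uz] := eqVneq u z.
    by move/pt_imP: va => [y ay]; exists y, v; rewrite -uz eq_sym.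
  by move/pt_imP: ua => [y ay]; exists y, u.
have [u' bx] := pt_ker_dom eqK ax; apply/pt_imP.
have [u'z|u'z] := eqVneq u' z; first by exists x; rewrite bx u'z.
by exists y; apply: sub ax bx u'z ay wz.
Qed.

Lemma star_edge_agreeP a b : pt_ker a = pt_ker b -> 1 < #|pt_im a| ->
  edge_sub E a b /\ edge_sub E b a <->
  (z \in pt_im a <-> z \in pt_im b) /\
  (z \in pt_im a -> pt_preim a z = pt_preim b z \/
     kernel_classes a = [set pt_preim a z; pt_preim b z]).
Proof.
move=> eqK gt1; have eqK' := esym eqK; split.
  move=> [sab sba]; have im_ab := star_center_im eqK sab gt1.
  have im_ba := star_center_im eqK' sba (pt_im_gt1_ker eqK gt1).
  split=> // za; have /pt_imP[xb bxb] := im_ab za; have /pt_imP[xa axa] := za.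
  move/(star_edge_subP eqK) in sab; move/(star_edge_subP eqK') in sba.
  have [eqP|neqP] := eqVneq (pt_preim a z) (pt_preim b z); [by left|right].
  have [u' bxa] := pt_ker_dom eqK axa; have [v' axb] := pt_ker_dom eqK' bxb.
  (* The central fibres differ, so [b] moves that of [a] off the center. Every other class then goes
     to the center under [b], which leaves only one such class. *)
  have u'z : u' != z.
    by apply: contraNneq neqP => eqz; rewrite (preim_ker eqK axa bxa) eqz.
  apply/eqP; rewrite eqEsubset; apply/andP; split; apply/subsetP => B.
    case/kernel_classesP => x [u [ax ->]]; rewrite !inE.
    have [->|uz] := eqVneq u z; first by rewrite eqxx.
    have bx := sab _ _ _ _ axa bxa u'z ax uz.
    by rewrite (preim_ker eqK ax bx) eqxx orbT.
  rewrite !inE => /orP[]/eqP->; first exact: preim_kernel_class axa.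
  by rewrite -(preim_ker eqK axb bxb); apply: preim_kernel_class axb.
move=> [imz cls].
(* If the two central fibres are the only classes, each point of the domain is sent to the center by
   [a] or by [b]. *)
have trans x u : z \in pt_im a -> a x = Some u ->
    pt_preim a z = pt_preim b z \/ a x = Some z \/ b x = Some z.
  move=> za ax; case: (cls za) => [->|eqC]; [by left|right].
  have := preim_kernel_class ax; rewrite eqC !inE => /orP[]/eqP/setP/(_ x).
    by rewrite !in_pt_preim ax eqxx => /esym/eqP; left.
  by rewrite !in_pt_preim ax eqxx => /esym/eqP; right.
split.
  apply/(star_edge_subP eqK) => x y u' v ax bx u'z ay vz.
  have za : z \in pt_im a by apply/pt_imP; exists x.
  have [eqP|[]] := trans _ _ za ay; last by [].
    move/setP/(_ x): eqP; rewrite !in_pt_preim ax bx eqxx => /esym/eqP[] /eqP.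
    by rewrite (negbTE u'z).
  by rewrite ay => -[eqz]; rewrite eqz eqxx in vz.
apply/(star_edge_subP eqK') => x y u' v bx ax u'z by_ vz.
have za : z \in pt_im a by apply/imz/pt_imP; exists x.
have [u ay] := pt_ker_dom eqK' by_.
have [eqP|[//|]] := trans _ _ za ay.
  move/setP/(_ x): eqP; rewrite !in_pt_preim ax bx eqxx => /eqP[] /eqP.
  by rewrite (negbTE u'z).
by rewrite by_ => -[eqz]; rewrite eqz eqxx in vz.
Qed.

(** Vacuous: an edge within the image would provide two image points. *)
Lemma star_edge_sub_im_le1 a b : #|pt_im a| <= 1 -> edge_sub E a b.
Proof.
move=> le1 x y u v u' v' ax ay _ _ uvE; suff : 1 < #|pt_im a| by rewrite ltnNge le1.
apply/pt_im_gt1P; exists x, y, u, v; split=> //.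
by move: uvE; rewrite star_edgeE => /andP[].
Qed.

End Star.

Theorem proposition2p5 (n : nat) (hn : 0 < n) (M : {set ptrans 'I_n})
    (hM : [\/ M = IEnd (star_edges hn),
              M = PEnd (star_edges hn)
            | M = PwEnd (star_edges hn)])
    (a b : ptrans 'I_n) (ha : a \in M) (hb : b \in M) :
  let z := star_center hn in
  greenR M a b <->
     (pt_ker a = pt_ker b /\ #|pt_im a| <= 1)
  \/ [/\ pt_ker a = pt_ker b,
         2 <= #|pt_im a|,
         (z \in pt_im a <-> z \in pt_im b)
       & (z \in pt_im a ->
            pt_preim a z = pt_preim b z
            \/ kernel_classes a = [set pt_preim a z; pt_preim b z])].
Proof.
move=> z.
have [Mcl IM MPw] : [/\ monoid_closed M, IEnd (star_edges hn) \subset M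
                      & M \subset PwEnd (star_edges hn)].
  have IP := IEnd_sub_PEnd (star_edges hn).
  have PPw := PEnd_sub_PwEnd (star_edges hn).
  case: hM => ->; split=> //.
  - exact: IEnd_monoid.
  - exact: subset_trans PPw.
  - exact: PEnd_monoid.
  - exact: PwEnd_monoid.
  - exact: subset_trans PPw.
apply: (iff_trans (greenR_edgeP (star_loopless hn) Mcl IM MPw a b)).
split=> [[eqK sab sba]|[[eqK le1]|[eqK gt1 imz cls]]].
- have [le1|gt1] := leqP #|pt_im a| 1; [by left|right].
  by have [] := (star_edge_agreeP hn eqK gt1).1 (conj sab sba).
- split=> //; apply: star_edge_sub_im_le1 => //.
  (* The bound passes to the image of [b], since both images count the classes of the same
     kernel. *)
  rewrite leqNgt; apply: contraTN le1 => gt1; rewrite -ltnNge.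
  exact: pt_im_gt1_ker (esym eqK) gt1.
- by have [] := (star_edge_agreeP hn eqK gt1).2 (conj imz cls).
Qed.
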